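(* Let $X$ be a Bishop topological group with Bishop topology $F$. If $C \subseteq X$ is closed in $X$, such that $X \setminus C$ is a subgroup of $X$ and $X \setminus_F C$ is inhabited, then $X \setminus C = X \setminus_F C$ and $X \setminus C$ is clopen (i.e. both closed and open).
   Context: The setting is Bishop-style constructive mathematics (BISH: intuitionistic logic, every set $X$ carries a given equality $=_X$, no countable choice). $\mathbb{F}(X)$ is the set of functions $X \to \mathbb{R}$ with pointwise equality. $\mathrm{Bic}(\mathbb{R})$ is the set of functions $\phi : \mathbb{R} \to \mathbb{R}$ that are uniformly continuous on every interval $[-n,n]$, $n \geq 1$. A Bishop space is a pair $(X,F)$, where $X$ is an inhabited set and $F \subseteq \mathbb{F}(X)$ is extensional (if $f \in F$ and $g$ is pointwise equal to $f$, then $g \in F$) such that: (BS1) all constant functions are in $F$; (BS2) $f, g \in F$ implies $f+g \in F$; (BS3) $f \in F$ and $\phi \in \mathrm{Bic}(\mathbb{R})$ imply $\phi \circ f \in F$; (BS4) if $f \in \mathbb{F}(X)$ and for every $\varepsilon > 0$ there is $g \in F$ with $|g(x) - f(x)| \leq \varepsilon$ for all $x \in X$, then $f \in F$. Then $F$ is called a Bishop topology on $X$. A Bishop morphism from $(X,F)$ to $(Y,G)$ is a function $h : X \to Y$ with $g \circ h \in F$ for every $g \in G$. The product topology $F \times G$ on $X \times Y$ is the least Bishop topology (inductively generated by the closure conditions (BS1)-(BS4) and extensionality) containing all $f \circ \pi_1$, $f \in F$, and all $g \circ \pi_2$, $g \in G$, where $\pi_1, \pi_2$ are the projections. A Bishop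 topological group is a (not necessarily abelian, additively written) group $(X,+,0,-)$ with a Bishop topology $F$ on $X$ such that $+ : X \times X \to X$ is a Bishop morphism from $(X \times X, F \times F)$ to $(X,F)$ and $- : X \to X$ is a Bishop morphism from $(X,F)$ to $(X,F)$. For $f \in F$ let $U(f) := \{x \in X \mid f(x) > 0\}$. A subset $O \subseteq X$ is open if for every $x \in O$ there is $f \in F$ with $f(x) > 0$ and $U(f) \subseteq O$. For $C \subseteq X$, the closure $\overline{C}$ consists of all $x \in X$ such that for every $f \in F$, if $f(x) > 0$ then there is $c \in C$ with $f(c) > 0$; $C$ is closed if $\overline{C} \subseteq C$. The set $X \setminus C$ is $\{x \in X \mid \neg(x \in C)\}$, and the $F$-complement of $C$ is $X \setminus_F C := \{x \in X \mid \exists_{f \in F}(f(x) > 0 \text{ and } \forall_{c \in C}(f(c) = 0))\}$. Inhabited means having an element. *)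

(* Defs.v *)
From Stdlib Require Import QArith Morphisms RelationClasses RelationPairs.
From Stdlib Require Export ConstructiveReals.

(** The real numbers are an arbitrary model [R] of the standard library's
    interface [ConstructiveReals]. The Cauchy reals (hence Bishop's reals) are
    one, and nothing in the interface is classical. All notions below are
    Prop-valued, so an existential quantifier gives no choice function. *)

Local Open Scope ConstructiveReals.

(** [CRlt] lives in [Set]; [CRltProp] is its propositional truncation and is
    logically equivalent to it ([CRltForget], [CRltEpsilon]). *)
Notation "x <p y" := (CRltProp _ x y) (at level 70) : ConstructiveReals.

Record bset := BSet {
  elt :> Type;
  eqset : elt -> elt -> Prop;
  eqset_equiv : Equivalence eqset }.

Arguments eqset {_} _ _.
#[global] Existing Instance eqset_equiv.

Notation "x =s y" := (eqset x y) (at level 70).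

Record bfun (X Y : bset) := BFun {
  ap :> X -> Y;
  ap_proper : Proper (eqset ==> eqset) ap }.

Arguments BFun {_ _} _ _.
Arguments ap {_ _} _ _.
Arguments ap_proper {_ _} _ _ _ _.
#[global] Existing Instance ap_proper.

Definition bset_prod (X Y : bset) : bset :=
  BSet (X * Y) (RelProd eqset eqset) (RelProd_Equivalence _ _ (eqset_equiv X) (eqset_equiv Y)).

Definition bset_R (R : ConstructiveReals) : bset :=
  BSet (CRcarrier R) (CReq R) CReq_rel.

Definition bcomp {X Y Z : bset} (g : bfun Y Z) (f : bfun X Y) : bfun X Z :=
  BFun (fun x => g (f x)) (fun x y e => ap_proper g _ _ (ap_proper f x y e)).

Definition bfst (X Y : bset) : bfun (bset_prod X Y) X :=
  BFun (X := bset_prod X Y) fst (fun p q e => proj1 e).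

Definition bsnd (X Y : bset) : bfun (bset_prod X Y) Y :=
  BFun (X := bset_prod X Y) snd (fun p q e => proj2 e).

(** Subsets of a set [X] are predicates that respect its equality. *)
Definition extensional {X : bset} (A : X -> Prop) : Prop :=
  Proper (eqset ==> iff) A.

Section Functions.
Context {R : ConstructiveReals}.

(** [RFun X] is the set of real-valued functions on [X]. *)
Definition RFun (X : bset) := bfun X (bset_R R).

Definition RFun_eq {X : bset} (f g : RFun X) : Prop := forall x, f x == g x.

Definition RFun_const {X : bset} (a : CRcarrier R) : RFun X :=
  BFun (Y := bset_R R) (fun _ => a) (fun _ _ _ => CReq_refl a).

Definition RFun_plus {X : bset} (f g : RFun X) : RFun X :=
  BFun (Y := bset_R R) (fun x => CRplus R (f x) (g x))
    (fun x y e => Radd_ext (CRisRingExt R)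
       _ _ (ap_proper f x y e) _ _ (ap_proper g x y e)).

Definition RFun_close {X : bset} (e : CRcarrier R) (g f : RFun X) : Prop :=
  forall x, CRabs R (CRminus R (g x) (f x)) <= e.

Definition Bic (phi : bfun (bset_R R) (bset_R R)) : Prop :=
  forall n : nat, (1 <= n)%nat ->
  let N := CR_of_Q R (inject_Z (Z.of_nat n)) in
  forall e : CRcarrier R, 0 <p e ->
  exists d : CRcarrier R, 0 <p d /\
    forall x y : CRcarrier R,
      - N <= x <= N -> - N <= y <= N ->
      CRabs R (x - y) <= d ->
      CRabs R (CRminus R (phi x) (phi y)) <= e.

Record bishop_topology (X : bset) (F : RFun X -> Prop) : Prop := {
  bt_ext : forall f g, F f -> RFun_eq g f -> F g;
  bt_const : forall a, F (RFun_const a);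
  bt_plus : forall f g, F f -> F g -> F (RFun_plus f g);
  bt_comp : forall f phi, F f -> Bic phi -> F (bcomp phi f);
  bt_unif : forall f,
    (forall e, 0 <p e -> exists g, F g /\ RFun_close e g f) -> F f }.

Inductive least_topology (X : bset) (F0 : RFun X -> Prop) : RFun X -> Prop :=
| lt_base f : F0 f -> least_topology X F0 f
| lt_ext f g : least_topology X F0 f -> RFun_eq g f -> least_topology X F0 g
| lt_const a : least_topology X F0 (RFun_const a)
| lt_plus f g : least_topology X F0 f -> least_topology X F0 g ->
    least_topology X F0 (RFun_plus f g)
| lt_comp f phi : least_topology X F0 f -> Bic phi ->
    least_topology X F0 (bcomp phi f)
| lt_unif f :
    (forall e, 0 <p e ->
       exists g, least_topology X F0 g /\ RFun_close e g f) ->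
    least_topology X F0 f.

Lemma least_topologyP (X : bset) (F0 : RFun X -> Prop) :
  bishop_topology X (least_topology X F0).
Proof.
  split.
  - apply lt_ext.
  - apply lt_const.
  - apply lt_plus.
  - apply lt_comp.
  - apply lt_unif.
Qed.

(** The scheme generated by Rocq has no induction hypothesis for [lt_unif],
    where the recursive occurrence is below [exists]. *)
Lemma least_topology_least (X : bset) (F0 G : RFun X -> Prop) :
  bishop_topology X G -> (forall f, F0 f -> G f) ->
  forall f, least_topology X F0 f -> G f.
Proof.
  intros HG H0. fix IH 2. intros f H. destruct H as [f H|f g H E|a|f g Hf Hg|f phi H B|f H].
  - exact (H0 f H).
  - exact (bt_ext _ _ HG f g (IH f H) E).
  - exact (bt_const _ _ HG a).
  - exact (bt_plus _ _ HG f g (IH f Hf) (IH g Hg)).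
  - exact (bt_comp _ _ HG f phi (IH f H) B).
  - apply (bt_unif _ _ HG f). intros e He.
    destruct (H e He) as [g [Hg C]]. exists g. exact (conj (IH g Hg) C).
Qed.

End Functions.

Arguments RFun : clear implicits.

Record BishopSpace (R : ConstructiveReals) := {
  bs_set :> bset;
  bs_top : RFun R bs_set -> Prop;
  bs_inhabited : inhabited bs_set;
  bs_topology : bishop_topology bs_set bs_top }.

Arguments bs_top {_} _ _.

Definition bishop_morphism {R : ConstructiveReals} (X Y : BishopSpace R)
    (h : bfun X Y) : Prop :=
  forall g : RFun R Y, bs_top Y g -> bs_top X (bcomp g h).

Definition product_base {R : ConstructiveReals} (X Y : BishopSpace R)
    (k : RFun R (bset_prod X Y)) : Prop :=
  (exists f, bs_top X f /\ RFun_eq k (bcomp f (bfst X Y))) \/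
  (exists g, bs_top Y g /\ RFun_eq k (bcomp g (bsnd X Y))).

Definition product_space {R : ConstructiveReals} (X Y : BishopSpace R) :
    BishopSpace R :=
  {| bs_set := bset_prod X Y;
     bs_top := least_topology (bset_prod X Y) (product_base X Y);
     bs_inhabited :=
       match bs_inhabited _ X, bs_inhabited _ Y with
       | inhabits x, inhabits y => inhabits (x, y)
       end;
     bs_topology := least_topologyP (bset_prod X Y) (product_base X Y) |}.

Record BishopTopGroup (R : ConstructiveReals) := {
  btg_space :> BishopSpace R;
  btg_add : bfun (product_space btg_space btg_space) btg_space;
  btg_zero : btg_space;
  btg_opp : bfun btg_space btg_space;
  btg_addA : forall x y z : btg_space,
    btg_add (x, btg_add (y, z)) =s btg_add (btg_add (x, y), z);
  btg_add0l : forall x : btg_space, btg_add (btg_zero, x) =s x;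
  btg_add0r : forall x : btg_space, btg_add (x, btg_zero) =s x;
  btg_addNl : forall x : btg_space, btg_add (btg_opp x, x) =s btg_zero;
  btg_addNr : forall x : btg_space, btg_add (x, btg_opp x) =s btg_zero;
  btg_add_morphism :
    bishop_morphism (product_space btg_space btg_space) btg_space btg_add;
  btg_opp_morphism : bishop_morphism btg_space btg_space btg_opp }.

Definition subgroup {R : ConstructiveReals} (X : BishopTopGroup R)
    (H : X -> Prop) : Prop :=
  H (btg_zero R X) /\
  (forall x y, H x -> H y -> H (btg_add R X (x, y))) /\
  (forall x, H x -> H (btg_opp R X x)).

Section Subsets.
Context {R : ConstructiveReals} (X : BishopSpace R).

Definition bs_U (f : RFun R X) : X -> Prop := fun x => 0 <p f x.

Definition bs_open (O : X -> Prop) : Prop :=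
  forall x, O x ->
  exists f, bs_top X f /\ 0 <p f x /\ forall y, bs_U f y -> O y.

Definition bs_closure (C : X -> Prop) : X -> Prop := fun x =>
  forall f, bs_top X f -> 0 <p f x -> exists c, C c /\ 0 <p f c.

Definition bs_closed (C : X -> Prop) : Prop :=
  forall x, bs_closure C x -> C x.

Definition bs_clopen (C : X -> Prop) : Prop := bs_closed C /\ bs_open C.

Definition setcompl (C : X -> Prop) : X -> Prop := fun x => ~ C x.

Definition Fcompl (C : X -> Prop) : X -> Prop := fun x =>
  exists f, bs_top X f /\ 0 <p f x /\ forall c, C c -> f c == 0.

End Subsets.

(* Main.v *)
Require Import Defs.
From Stdlib Require Import Morphisms.

(** Write [H] for the complement of [C]. A function [f] in the topology which
    vanishes on [C] and is positive at [x] shows that [x] is in [H], so one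
    inclusion is immediate. Conversely, fix [f] vanishing on [C] and positive
    at some [x0]; then [x0] is in [H]. For [x] in [H] put [a = x0 - x], again an
    element of [H], and translate: [y |-> f (a + y)] is positive at [x], and it
    belongs to the topology since translations are Bishop morphisms
    ([left_translation_morphism]).

    It also vanishes on [C]. If [a + c] were in [H], so would be
    [c = - a + (a + c)]; hence [a + c] is in [C] up to double negation, which
    is enough because equality of reals is the negation of a strict inequality
    in either direction, hence stable ([eq0_off_complement]). So [H] is the
    [F]-complement of [C].

    An [F]-complement is open, since the function witnessing membership of one
    point serves at every point where it is positive. Finally, an open subgroup
    is closed ([subgroup_closed]), by the classical argument: take [g] positive
    at [0] and positive only on [H]. If [x] is in the closure of [H], the
    translate [y |-> g (- x + y)], being positive at [x], is positive at some
    [h] in [H]. So [- x + h] is in [H], and therefore [x] is in [H]. *)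

Local Open Scope ConstructiveReals.

(** The largest topology making [h] a morphism. Through
    [least_topology_least], it reduces a statement about all functions in a
    generated topology on [Y] to one about its generators. *)
Lemma pushforward_topology {R : ConstructiveReals} (Z Y : bset)
    (F : RFun R Z -> Prop) (h : bfun Z Y) :
  bishop_topology Z F -> bishop_topology Y (fun k : RFun R Y => F (bcomp k h)).
Proof.
  intros [Fext Fconst Fplus Fcomp Funif]; split.
  - intros f g Ff E. exact (Fext _ (bcomp g h) Ff (fun z => E (h z))).
  - intros a. exact (Fext _ (bcomp (RFun_const a) h) (Fconst a) (fun z => CReq_refl _)).
  - intros f g Ff Fg. exact (Fext _ (bcomp (RFun_plus f g) h) (Fplus _ _ Ff Fg) (fun z => CReq_refl _)).
  - intros f phi Ff B. exact (Fext _ (bcomp (bcomp phi f) h) (Fcomp _ _ Ff B) (fun z => CReq_refl _)).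
  - intros f Hf. apply Funif. intros e He.
    destruct (Hf e He) as [g [Fg Hg]].
    exists (bcomp g h). exact (conj Fg (fun z => Hg (h z))).
Qed.

Lemma product_morphism {R : ConstructiveReals} (Z X Y : BishopSpace R)
    (h : bfun Z (product_space X Y)) :
  bishop_morphism Z X (bcomp (bfst X Y) h) ->
  bishop_morphism Z Y (bcomp (bsnd X Y) h) ->
  bishop_morphism Z (product_space X Y) h.
Proof.
  intros h1 h2 k.
  refine (least_topology_least _ (product_base X Y)
            (fun k : RFun R (bset_prod X Y) => bs_top Z (bcomp k h)) _ _ k).
  - exact (pushforward_topology Z _ _ h (bs_topology _ Z)).
  - intros f [[g [Fg E]]|[g [Fg E]]].
    + exact (bt_ext _ _ (bs_topology _ Z) _ (bcomp f h) (h1 g Fg) (fun z => E (h z))).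
    + exact (bt_ext _ _ (bs_topology _ Z) _ (bcomp f h) (h2 g Fg) (fun z => E (h z))).
Qed.

Definition pair_left {X : bset} (a : X) : bfun X (bset_prod X X) :=
  BFun (Y := bset_prod X X) (fun y => (a, y))
    (fun y z e => conj (reflexivity a) e).

Definition left_translation {R : ConstructiveReals} (X : BishopTopGroup R)
    (a : X) : bfun X X :=
  bcomp (btg_add R X) (pair_left a).

Lemma left_translation_morphism {R : ConstructiveReals} (X : BishopTopGroup R)
    (a : X) : bishop_morphism X X (left_translation X a).
Proof.
  intros f Ff.
  refine (product_morphism X X X (pair_left a) _ _ _
            (btg_add_morphism R X f Ff)).
  - intros g Fg.
    exact (bt_ext _ _ (bs_topology _ X) _ (bcomp g (bcomp (bfst X X) (pair_left a)))
             (bt_const _ _ (bs_topology _ X) (g a)) (fun z => CReq_refl _)).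
  - intros g Fg.
    exact (bt_ext _ _ (bs_topology _ X) _ (bcomp g (bcomp (bsnd X X) (pair_left a)))
             Fg (fun z => CReq_refl _)).
Qed.

#[local] Instance add_pair_proper {R : ConstructiveReals}
    (X : BishopTopGroup R) :
  Proper (eqset ==> eqset ==> eqset) (fun x y : X => btg_add R X (x, y)).
Proof.
  intros x x' e y y' e'. exact (ap_proper (btg_add R X) (x, y) (x', y') (conj e e')).
Qed.

Lemma add_oppK {R : ConstructiveReals} (X : BishopTopGroup R) (x y : X) :
  btg_add R X (btg_opp R X x, btg_add R X (x, y)) =s y.
Proof.
  etransitivity; [apply btg_addA|].
  etransitivity; [|apply btg_add0l].
  apply (add_pair_proper X); [apply btg_addNl|reflexivity].
Qed.

Lemma add_subK {R : ConstructiveReals} (X : BishopTopGroup R) (x y : X) :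
  btg_add R X (btg_add R X (x, btg_opp R X y), y) =s x.
Proof.
  etransitivity; [symmetry; apply btg_addA|].
  etransitivity; [|apply btg_add0r].
  apply (add_pair_proper X); [reflexivity|apply btg_addNl].
Qed.

Lemma sub_addK {R : ConstructiveReals} (X : BishopTopGroup R) (x y : X) :
  btg_add R X (btg_add R X (x, y), btg_opp R X y) =s x.
Proof.
  etransitivity; [symmetry; apply btg_addA|].
  etransitivity; [|apply btg_add0r].
  apply (add_pair_proper X); [reflexivity|apply btg_addNr].
Qed.

Lemma opp_opp {R : ConstructiveReals} (X : BishopTopGroup R) (x : X) :
  btg_opp R X (btg_opp R X x) =s x.
Proof.
  etransitivity; [|exact (add_oppK X (btg_opp R X x) x)].
  etransitivity; [symmetry; apply btg_add0r|].
  apply (add_pair_proper X); [reflexivity|symmetry; apply btg_addNl].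
Qed.

Lemma subgroup_cancel_left {R : ConstructiveReals} (X : BishopTopGroup R)
    (H : X -> Prop) (a y : X) :
  extensional H -> subgroup X H -> H a -> H (btg_add R X (a, y)) -> H y.
Proof.
  intros hext [_ [hadd hopp]] Ha Hay.
  apply (hext _ _ (add_oppK X a y)). apply hadd; [exact (hopp a Ha)|exact Hay].
Qed.

Lemma subgroup_of_opp_add {R : ConstructiveReals} (X : BishopTopGroup R)
    (H : X -> Prop) (x h : X) :
  extensional H -> subgroup X H ->
  H h -> H (btg_add R X (btg_opp R X x, h)) -> H x.
Proof.
  intros hext [_ [hadd hopp]] Hh Hxh.
  apply (hext _ _ (opp_opp X x)). apply hopp.
  apply (hext _ _ (sub_addK X (btg_opp R X x) h)).
  apply hadd; [exact Hxh|exact (hopp h Hh)].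
Qed.

Lemma setcompl_extensional {R : ConstructiveReals} (X : BishopSpace R)
    (C : X -> Prop) : extensional C -> extensional (setcompl X C).
Proof.
  intros hC x y e. unfold setcompl. rewrite (hC x y e). reflexivity.
Qed.

Lemma positive_ext {R : ConstructiveReals} {X : bset} (f : RFun R X) (x y : X) :
  x =s y -> 0 <p f x -> 0 <p f y.
Proof.
  intros e Hx. apply CRltForget.
  apply (CRlt_le_trans _ _ _ (CRltEpsilon R _ _ Hx)).
  exact (proj2 (ap_proper f x y e)).
Qed.

Lemma Fcompl_setcompl {R : ConstructiveReals} (X : BishopSpace R)
    (C : X -> Prop) (x : X) : Fcompl X C x -> setcompl X C x.
Proof.
  intros [f [_ [fx f0]]] Cx.
  exact (proj2 (f0 x Cx) (CRltEpsilon R _ _ fx)).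
Qed.

Lemma Fcompl_open {R : ConstructiveReals} (X : BishopSpace R)
    (C : X -> Prop) : bs_open X (Fcompl X C).
Proof.
  intros x [f [Ff [fx f0]]]. exists f. repeat split; try assumption.
  intros y fy. exists f. repeat split; assumption || apply f0; assumption.
Qed.

(** Both halves of an equality of reals are negations, so a doubly negated
    hypothesis may be used to prove it. *)
Lemma eq0_off_complement {R : ConstructiveReals} (X : BishopSpace R)
    (C : X -> Prop) (f : RFun R X) (y : X) :
  (forall c, C c -> f c == 0) -> ~ setcompl X C y -> f y == 0.
Proof.
  intros f0 nny. split; intro lt; apply nny; intro Cy.
  - exact (proj1 (f0 y Cy) lt).
  - exact (proj2 (f0 y Cy) lt).
Qed.

(** One witness suffices: it is moved to any other point of the subgroup by a
    translation, which preserves [C] up to double negation. *)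
Lemma setcompl_Fcompl {R : ConstructiveReals} (X : BishopTopGroup R)
    (C : X -> Prop) :
  extensional C -> subgroup X (setcompl X C) ->
  (exists x : X, Fcompl X C x) ->
  forall x : X, setcompl X C x -> Fcompl X C x.
Proof.
  intros hC hsub [x0 Fx0] x Hx.
  pose proof (Fcompl_setcompl X C x0 Fx0) as Hx0.
  destruct Fx0 as [f [Ff [fx0 f0]]].
  set (a := btg_add R X (x0, btg_opp R X x)).
  assert (Ha : setcompl X C a).
  { destruct hsub as [_ [hadd hopp]].
    apply hadd; [exact Hx0|exact (hopp x Hx)]. }
  exists (bcomp f (left_translation X a)). split; [|split].
  - exact (left_translation_morphism X a f Ff).
  - exact (positive_ext f x0 _ (symmetry (add_subK X x0 x)) fx0).
  - intros c Cc. apply (eq0_off_complement X C f _ f0). intro Hac.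
    exact (subgroup_cancel_left X _ a c (setcompl_extensional X C hC)
             hsub Ha Hac Cc).
Qed.

(** The coset [x + H] is a neighbourhood of [x], so it meets [H] whenever [x] is
    in the closure of [H]; a coset that meets [H] is [H] itself. *)
Lemma subgroup_closed {R : ConstructiveReals} (X : BishopTopGroup R)
    (H : X -> Prop) :
  extensional H -> subgroup X H -> bs_open X H -> bs_closed X H.
Proof.
  intros hext hsub hopen x clx.
  destruct (hopen _ (proj1 hsub)) as [g [Fg [g0 gH]]].
  destruct (clx (bcomp g (left_translation X (btg_opp R X x)))
              (left_translation_morphism X _ g Fg)) as [h [Hh gh]].
  - exact (positive_ext g _ _ (symmetry (btg_addNl R X x)) g0).
  - exact (subgroup_of_opp_add X H x h hext hsub Hh (gH _ gh)).
Qed.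

Theorem corollary5p10 (R : ConstructiveReals) (X : BishopTopGroup R)
    (C : X -> Prop) (hC : extensional C)
    (hclosed : bs_closed X C)
    (hsub : subgroup X (setcompl X C))
    (hinh : exists x : X, Fcompl X C x) :
  (forall x : X, setcompl X C x <-> Fcompl X C x) /\
  bs_clopen X (setcompl X C).
Proof.
  pose proof (setcompl_Fcompl X C hC hsub hinh) as hF.
  assert (hopen : bs_open X (setcompl X C)).
  { intros x Hx.
    destruct (Fcompl_open X C x (hF x Hx)) as [f [Ff [fx fU]]].
    exists f. repeat split; try assumption.
    intros y fy. exact (Fcompl_setcompl X C y (fU y fy)). }
  split; [|split].
  - intro x. split; [exact (hF x)|exact (Fcompl_setcompl X C x)].
  - exact (subgroup_closed X _ (setcompl_extensional X C hC) hsub hopen).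
  - exact hopen.
Qed.
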